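(* Let $V$ be a non-empty finite set and let $R:V\times V\to 2^V$ be a poset function such that (r) for all $u,v\in V$: if $R(u,v)=R(v,u)=\emptyset$ then there is $w\in V$ with $R(w,u)\neq\emptyset$ and $R(w,v)\neq\emptyset$; and (p) for all $u,v,w\in V$: $w\in R(u,v)$ implies $R(u,w)\cup R(w,v)=R(u,v)$. Let $G_R$ be the underlying digraph of $R$ and $R_{G_R}$ the all-paths transit function of $G_R$. Then $G_R$ is a directed rooted tree and $R=R_{G_R}$.
   Context: A directed transit function on a finite set $V$ is a function $R:V\times V\to 2^V$ satisfying (t0) for all $u,v,w\in V$: if $R(u,w)\neq\emptyset$ and $R(w,v)\neq\emptyset$ then $R(u,v)\neq\emptyset$; (t1) for all $u,v\in V$: if $R(u,v)\neq\emptyset$ then $\{u,v\}\subseteq R(u,v)$; (t3) $R(u,u)=\{u\}$ for all $u\in V$. A poset function is a directed transit function that in addition satisfies (t2a) for all $u,v\in V$: if $R(u,v)\neq\emptyset$ and $u\neq v$ then $R(v,u)=\emptyset$; (tr1) for all $u,v,w\in V$ with $u\neq v$: if $R(u,w)\neq\emptyset$ and $R(w,v)\neq\emptyset$ then $R(u,w)\cup R(w,v)\subseteq R(u,v)$; (tr2) for all $u,v,w\in V$ with $u\neq v$: if $R(u,w)=\emptyset$ or $R(w,v)=\emptyset$ then $w\notin R(u,v)$. The underlying digraph $G_R$ of $R$ has vertex set $V$, and $(x,y)$ is a directed edge of $G_R$ if and only if $x\neq y$ and $R(x,y)=\{x,y\}$. A directed path from $u$ to $v$ is a sequence $(x_0=u,x_1,\dots,x_n=v)$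 of pairwise distinct vertices with each $(x_{i-1},x_i)$ an edge; $n=0$ is allowed. For a digraph $G$ with vertex set $V$, the all-paths transit function $R_G$ is $R_G(u,v)=\{x\in V\mid x \text{ lies on a directed path from } u \text{ to } v \text{ in } G\}$. In a directed acyclic graph (DAG), a hybrid vertex is a vertex with more than one incoming edge; a root is a vertex without incoming edges from which there is a directed path to every other vertex. A rooted (directed) tree is a DAG that contains a root and has no hybrid vertices. *)

(* Defs.v *)
(* Rocq + Mathematical Components.  A map V x V -> 2^V is written in curried
   form as R : V -> V -> {set V}; a digraph on V is a relation e : rel V, with
   e x y meaning that (x, y) is a directed edge. *)
From mathcomp Require Import all_boot.
From mathcomp Require Import boolp.

Set Implicit Arguments.
Unset Strict Implicit.
Unset Printing Implicit Defensive.

Record directed_transit (V : finType) (R : V -> V -> {set V}) : Prop :=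
  DirectedTransit {
    transit_t0 : forall u v w,
      R u w != set0 -> R w v != set0 -> R u v != set0;
    transit_t1 : forall u v, R u v != set0 -> [set u; v] \subset R u v;
    transit_t3 : forall u, R u u = [set u]
  }.

Record poset_function (V : finType) (R : V -> V -> {set V}) : Prop :=
  PosetFunction {
    poset_transit : directed_transit R;
    poset_t2a : forall u v, R u v != set0 -> u != v -> R v u = set0;
    poset_tr1 : forall u v w, u != v ->
      R u w != set0 -> R w v != set0 -> R u w :|: R w v \subset R u v;
    poset_tr2 : forall u v w, u != v ->
      R u w = set0 \/ R w v = set0 -> w \notin R u v
  }.

Definition underlying_digraph (V : finType) (R : V -> V -> {set V}) : rel V :=
  fun x y => (x != y) && (R x y == [set x; y]).

(* The vertices of the path are u :: p; the case p = [::] is the path of length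
   0 from u to u. *)
Definition dipath (V : finType) (e : rel V) (u v : V) (p : seq V) : bool :=
  [&& path e u p, last u p == v & uniq (u :: p)].

(* `[< _ >] is the classical truth value, needed because p ranges over an
   infinite type. *)
Definition all_paths (V : finType) (e : rel V) (u v : V) : {set V} :=
  [set x | `[< exists p : seq V, dipath e u v p /\ x \in u :: p >]].

Definition acyclic_digraph (V : finType) (e : rel V) : Prop :=
  forall c : seq V, c <> [::] -> ~ ucycle e c.

Definition hybrid (V : finType) (e : rel V) (v : V) : bool :=
  1 < #|[set x | e x v]|.

Definition is_root (V : finType) (e : rel V) (r : V) : Prop :=
  (forall x, ~~ e x r) /\
  (forall v, v != r -> exists p : seq V, dipath e r v p).

Definition rooted_tree (V : finType) (e : rel V) : Prop :=
  [/\ acyclic_digraph e, exists r, is_root e r & forall v, ~~ hybrid e v].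

(* Main.v *)
(* The relation [R u v != set0] is a partial order and [R u v] is its interval
   [u, v], so [underlying_digraph R] is the covering relation. By (p) intervals
   are chains. By (r) any two vertices have a common lower bound, so a vertex
   with fewest lower bounds is the minimum, which is the root. Two vertices
   below [v] lie in an interval [w, v], hence are comparable; so [v] covers at
   most one vertex. *)
Require Import Defs.
From mathcomp Require Import all_boot.
From mathcomp Require Import boolp.

Set Implicit Arguments.
Unset Strict Implicit.

Definition transit_le (V : finType) (R : V -> V -> {set V}) : rel V :=
  fun u v => R u v != set0.

Definition transit_lt (V : finType) (R : V -> V -> {set V}) : rel V :=
  fun u v => (u != v) && transit_le R u v.

Lemma path_le_last (T : eqType) (le : rel T) (u : T) (p : seq T) :
  reflexive le -> transitive le -> path le u p -> le u (last u p).
Proof.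
move=> le_refl le_trans; rewrite (path_sortedE le_trans) => /andP[/allP le_u _].
by have := mem_last u p; rewrite inE => /predU1P[->|/le_u].
Qed.

Lemma transit_le_refl (V : finType) (R : V -> V -> {set V}) :
  poset_function R -> reflexive (transit_le R).
Proof.
by case=> -[_ _ t3] _ _ _ u; apply/set0Pn; exists u; rewrite t3 set11.
Qed.

Lemma transit_le_trans (V : finType) (R : V -> V -> {set V}) :
  poset_function R -> transitive (transit_le R).
Proof. by case=> -[t0 _ _] _ _ _ v u w; apply: t0. Qed.

Lemma transit_le_anti (V : finType) (R : V -> V -> {set V}) :
  poset_function R -> antisymmetric (transit_le R).
Proof.
case=> _ t2a _ _ u v /andP[le_uv le_vu]; apply/eqP; apply: contraT => neq_uv.
by move: le_vu; rewrite /transit_le (t2a _ _ le_uv neq_uv) eqxx.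
Qed.

Lemma transit_lt_trans (V : finType) (R : V -> V -> {set V}) :
  poset_function R -> transitive (transit_lt R).
Proof.
move=> Rpos v u w /andP[neq_uv le_uv] /andP[_ le_vw]; apply/andP; split.
  (* If [u = w], then [u] and [v] lie below each other, and antisymmetry contradicts [u != v]. *)
  apply: contraNneq neq_uv => eq_uw; apply/eqP.
  by apply: (transit_le_anti Rpos); rewrite le_uv eq_uw.
exact: transit_le_trans le_uv le_vw.
Qed.

Lemma transit_lt_irr (V : finType) (R : V -> V -> {set V}) :
  irreflexive (transit_lt R).
Proof. by move=> u; rewrite /transit_lt eqxx. Qed.

(** For [u != v], (tr2) gives the inequalities and (tr1) with (t1) gives membership. Both axioms
    exclude [u = v], where (t3) and antisymmetry take over. *)
Lemma mem_transit (V : finType) (R : V -> V -> {set V}) (u v w : V) :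
  poset_function R ->
  (w \in R u v) = transit_le R u w && transit_le R w v.
Proof.
move=> Rpos; case: (Rpos) => -[_ t1 t3] _ tr1 tr2.
have [<-|neq_uv] := eqVneq u v.
  rewrite t3 inE; apply/eqP/idP => [->|le_uwu].
    by rewrite transit_le_refl.
  by symmetry; apply: (transit_le_anti Rpos).
apply/idP/andP => [Ruv_w|[le_uw le_wv]].
  by split; apply: contraTneq Ruv_w => R0; apply: tr2; auto.
apply: (subsetP (tr1 u v w neq_uv le_uw le_wv)).
by rewrite inE (subsetP (t1 _ _ le_uw)) // !inE eqxx orbT.
Qed.

Lemma underlying_digraph_lt (V : finType) (R : V -> V -> {set V}) :
  subrel (underlying_digraph R) (transit_lt R).
Proof.
move=> u v /andP[neq_uv /eqP Ruv]; rewrite /transit_lt neq_uv.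
by apply/set0Pn; exists u; rewrite Ruv !inE eqxx.
Qed.

(** Edges are strict inequalities, so a path is strictly increasing. The distinctness clause of
    [dipath] is thus automatic. *)
Lemma path_underlying_uniq (V : finType) (R : V -> V -> {set V}) (u : V)
    (p : seq V) :
  poset_function R -> path (underlying_digraph R) u p -> uniq (u :: p).
Proof.
move=> Rpos /(sub_path (@underlying_digraph_lt _ _)) lt_p.
exact: (sorted_uniq (transit_lt_trans Rpos) (transit_lt_irr R) (s := u :: p)).
Qed.

Lemma path_underlying_le (V : finType) (R : V -> V -> {set V}) (u : V)
    (p : seq V) :
  poset_function R -> path (underlying_digraph R) u p ->
  transit_le R u (last u p).
Proof.
move=> Rpos path_p.
apply: path_le_last (transit_le_refl Rpos) (transit_le_trans Rpos) _.
by apply: sub_path path_p => x y /underlying_digraph_lt/andP[].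
Qed.

(** Strong induction on the size of the interval: either it is [[set u; v]] and gives an edge, or an
    interior point [w] splits it into two smaller intervals whose paths are concatenated. *)
Lemma underlying_path_exists (V : finType) (R : V -> V -> {set V}) (u v : V) :
  poset_function R -> transit_le R u v ->
  exists2 p, path (underlying_digraph R) u p & last u p = v.
Proof.
move=> Rpos; have [n] := ubnP #|R u v|; elim: n u v => // n IHn u v.
rewrite ltnS => Ruv_n le_uv.
have [<-|neq_uv] := eqVneq u v; first by exists [::].
have [Ruv|] := eqVneq (R u v) [set u; v].
  by exists [:: v]; rewrite //= /underlying_digraph neq_uv Ruv eqxx.
have sub_uv := transit_t1 (poset_transit Rpos) le_uv.
rewrite eqEsubset sub_uv andbT => /subsetPn[w Ruv_w].
rewrite !inE negb_or => /andP[neq_wu neq_wv].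
have /andP[le_uw le_wv] : transit_le R u w && transit_le R w v.
  by rewrite -mem_transit.
have [p path_p last_p] : exists2 p, path (underlying_digraph R) u p & last u p = w.
  apply: IHn le_uw; apply: leq_trans Ruv_n; apply/proper_card/properP; split.
    apply/subsetP=> x; rewrite !mem_transit // => /andP[-> le_xw].
    exact: (transit_le_trans Rpos) le_xw le_wv.
  (* The inclusion is strict: [v] in [R u w] would give [v = w] by antisymmetry. *)
  exists v; first by rewrite (subsetP sub_uv) // !inE eqxx orbT.
  rewrite mem_transit // le_uv /=; apply: contra neq_wv => le_vw.
  by apply/eqP/(transit_le_anti Rpos); rewrite le_wv.
have [q path_q last_q] : exists2 q, path (underlying_digraph R) w q & last w q = v.
  apply: IHn le_wv; apply: leq_trans Ruv_n; apply/proper_card/properP; split.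
    apply/subsetP=> x; rewrite !mem_transit // => /andP[le_wx ->].
    by rewrite andbT; exact: (transit_le_trans Rpos) le_uw le_wx.
  exists u; first by rewrite (subsetP sub_uv) // !inE eqxx.
  rewrite mem_transit // le_uv andbT; apply: contra neq_wu => le_wu.
  by apply/eqP/(transit_le_anti Rpos); rewrite le_wu.
by exists (p ++ q); rewrite ?cat_path ?last_cat last_p // path_p.
Qed.

Lemma underlying_acyclic (V : finType) (R : V -> V -> {set V}) :
  poset_function R -> acyclic_digraph (underlying_digraph R).
Proof.
(* A cycle [x :: p] is a path from [x] along [rcons p x], in which [x] repeats. *)
move=> Rpos [//|x p] _ /andP[/(path_underlying_uniq Rpos)].
by rewrite /= mem_rcons inE eqxx.
Qed.

(** A point of the interval lies on the concatenation of a path up to it and a path from it.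
    Conversely, cutting a path at one of its vertices yields the two inequalities. *)
Lemma transit_all_paths (V : finType) (R : V -> V -> {set V}) :
  poset_function R -> R =2 all_paths (underlying_digraph R).
Proof.
move=> Rpos u v; apply/setP=> x; rewrite mem_transit // inE.
apply/andP/asboolP => [[le_ux le_xv]|[p [/and3P[path_p /eqP last_p _] p_x]]].
  have [p path_p last_p] := underlying_path_exists Rpos le_ux.
  have [q path_q last_q] := underlying_path_exists Rpos le_xv.
  have path_pq : path (underlying_digraph R) u (p ++ q).
    by rewrite cat_path last_p path_p.
  exists (p ++ q); split.
    rewrite /dipath path_pq last_cat last_p last_q eqxx.
    exact: (path_underlying_uniq Rpos).
  by rewrite -cat_cons mem_cat -{1}last_p mem_last.
case/splitPl: p_x path_p last_p => p1 p2 last_p1.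
rewrite cat_path last_cat last_p1 => /andP[path_p1 path_p2] <-.
by rewrite -{1}last_p1; split; apply: path_underlying_le.
Qed.

(** Condition (r) speaks of incomparable pairs; in a comparable pair the smaller element serves. *)
Lemma transit_lower_bound (V : finType) (R : V -> V -> {set V}) (u v : V) :
  poset_function R ->
  (forall u v : V, R u v = set0 -> R v u = set0 ->
     exists w : V, R w u != set0 /\ R w v != set0) ->
  exists w, transit_le R w u /\ transit_le R w v.
Proof.
move=> Rpos R_r.
have [Ruv|le_uv] := eqVneq (R u v) set0; last first.
  by exists u; split; rewrite ?transit_le_refl.
have [Rvu|le_vu] := eqVneq (R v u) set0; last first.
  by exists v; split; rewrite ?transit_le_refl.
exact: R_r.
Qed.

Lemma transit_minimum (V : finType) (R : V -> V -> {set V}) :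
  0 < #|V| -> poset_function R ->
  (forall u v : V, R u v = set0 -> R v u = set0 ->
     exists w : V, R w u != set0 /\ R w v != set0) ->
  exists r, forall v, transit_le R r v.
Proof.
case/card_gt0P=> v0 _ Rpos R_r; pose down x := [set y | transit_le R y x].
case: (arg_minnP (P := xpredT) (fun x => #|down x|) (isT : xpredT v0)).
move=> r _ min_r; exists r => v.
have [w [le_wr le_wv]] := transit_lower_bound r v Rpos R_r.
(* If [r] were not below [w], then [down w] would be a proper subset of [down r], since it misses
   [r]; this contradicts the choice of [r]. *)
suff -> : r = w by [].
apply: (transit_le_anti Rpos); rewrite le_wr andbT.
apply: contraT => nle_rw; have := min_r w isT.
rewrite leqNgt => /negP[]; apply/proper_card/properP; split.
  apply/subsetP=> x; rewrite !inE => le_xw.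
  exact: (transit_le_trans Rpos) le_xw le_wr.
by exists r; rewrite !inE // transit_le_refl.
Qed.

Lemma minimum_is_root (V : finType) (R : V -> V -> {set V}) (r : V) :
  poset_function R -> (forall v, transit_le R r v) ->
  is_root (underlying_digraph R) r.
Proof.
move=> Rpos min_r; split=> [x|v _].
  apply/negP=> /underlying_digraph_lt/andP[/eqP neq_xr le_xr]; apply: neq_xr.
  by apply: (transit_le_anti Rpos); rewrite le_xr min_r.
have [p path_p last_p] := underlying_path_exists Rpos (min_r v).
exists p; rewrite /dipath path_p last_p eqxx.
exact: (path_underlying_uniq Rpos).
Qed.

(** Here [y] lies in [R x v], which is [[set x; v]] because of the edge. Hence two comparable
    parents of [v] coincide. *)
Lemma underlying_edge_le (V : finType) (R : V -> V -> {set V}) (x y v : V) :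
  poset_function R ->
  underlying_digraph R x v -> transit_lt R y v -> transit_le R x y ->
  x = y.
Proof.
move=> Rpos /andP[_ /eqP Rxv] /andP[neq_yv le_yv] le_xy.
have: y \in R x v by rewrite mem_transit // le_xy.
by rewrite Rxv !inE (negPf neq_yv) orbF => /eqP.
Qed.

Lemma underlying_not_hybrid (V : finType) (R : V -> V -> {set V}) (v : V) :
  poset_function R ->
  (forall u v : V, R u v = set0 -> R v u = set0 ->
     exists w : V, R w u != set0 /\ R w v != set0) ->
  (forall u v w : V, w \in R u v -> R u w :|: R w v = R u v) ->
  ~~ hybrid (underlying_digraph R) v.
Proof.
move=> Rpos R_r R_p; rewrite /hybrid -leqNgt; apply/card_le1P=> x.
rewrite inE => edge_xv y; rewrite !inE; apply/idP/eqP => [edge_yv|-> //].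
have lt_xv := underlying_digraph_lt edge_xv.
have lt_yv := underlying_digraph_lt edge_yv.
have [w [le_wx le_wy]] := transit_lower_bound x y Rpos R_r.
have /R_p split_x : x \in R w v.
  by rewrite mem_transit // le_wx; case/andP: lt_xv.
have : y \in R w v by rewrite mem_transit // le_wy; case/andP: lt_yv.
(* By (p), [R w v] is the union of [R w x] and [R x v], so [y] is below or above [x]. *)
rewrite -split_x inE !mem_transit // => /orP[/andP[_ le_yx]|/andP[le_xy _]].
  exact: (underlying_edge_le Rpos edge_yv lt_xv le_yx).
by symmetry; apply: (underlying_edge_le Rpos edge_xv lt_yv le_xy).
Qed.

Theorem theorem28 (V : finType) (R : V -> V -> {set V})
  (V_nonempty : 0 < #|V|)
  (R_poset : poset_function R)
  (R_r : forall u v : V, R u v = set0 -> R v u = set0 ->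
     exists w : V, R w u != set0 /\ R w v != set0)
  (R_p : forall u v w : V, w \in R u v -> R u w :|: R w v = R u v) :
  rooted_tree (underlying_digraph R) /\
  R =2 all_paths (underlying_digraph R).
Proof.
split; last exact: transit_all_paths.
split; first exact: underlying_acyclic.
  have [r min_r] := transit_minimum V_nonempty R_poset R_r.
  by exists r; apply: minimum_is_root.
by move=> v; apply: underlying_not_hybrid.
Qed.
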